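(* $1$-occurrence TAP is solvable exactly in polynomial time.
   Context: Target Approximation Problem (TAP): the input is a groundset $U=\{1,\dots,n\}$ of features, a target $T\subseteq U$, and a collection $S=\{E_1,\dots,E_m\}$ of exemplars, each $E_j\subseteq U$. Features in $U\cap T$ are blue, features in $U\setminus T$ are red. A feature appears in $S'\subseteq S$ if it lies in $\bigcup_{E\in S'}E$. The margin of $S'$ is (number of blue features appearing in $S'$) minus (number of red features appearing in $S'$); TAP asks for $S'$ of maximum margin. It is assumed that every feature appears in at least one exemplar and that $T$ and all exemplars are nonempty. $k$-occurrence TAP is TAP restricted to instances in which every feature belongs to at most $k$ exemplars. *)

(* Defs.v *)
From mathcomp Require Import all_boot all_algebra.
Set Implicit Arguments. Unset Strict Implicit. Unset Printing Implicit Defensive.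
Import GRing.Theory Num.Theory.

(* An instance: n (groundset U = {1..n}), target T (list of features, read as a
   set), exemplars S = [E_1; ...; E_m] (each a list of features, read as a set).
   A sub-collection S' of S is given by a list J of indices (0-based) into S. *)

Definition appears (S : seq (seq nat)) (J : seq nat) (x : nat) : bool :=
  has (fun j => (j < size S) && (x \in nth [::] S j)) J.

Definition blue_count (n : nat) (T : seq nat) (S : seq (seq nat)) (J : seq nat) : nat :=
  count (fun x => (x \in T) && appears S J x) (iota 1 n).

Definition red_count (n : nat) (T : seq nat) (S : seq (seq nat)) (J : seq nat) : nat :=
  count (fun x => (x \notin T) && appears S J x) (iota 1 n).

Definition margin (n : nat) (T : seq nat) (S : seq (seq nat)) (J : seq nat) : int :=
  ((blue_count n T S J)%:Z - (red_count n T S J)%:Z)%R.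

Definition in_U (n x : nat) : bool := (0 < x) && (x <= n).

Definition valid_instance (n : nat) (T : seq nat) (S : seq (seq nat)) : Prop :=
  [/\ all (in_U n) T, all (all (in_U n)) S,
      (forall x, in_U n x -> has (fun E => x \in E) S),
      T != [::] & all (fun E => E != [::]) S].

Definition k_occurrence (k : nat) (S : seq (seq nat)) : Prop :=
  forall x : nat, count (fun E => x \in E) S <= k.

Inductive instr : Type :=
| IConst of nat & nat
| IAdd of nat & nat & nat
| ISub of nat & nat & nat    (* ISub r a b   : M[r] := M[a] - M[b] (truncated) *)
| ILoad of nat & nat
| IStore of nat & nat
| IJz of nat & nat
| IJmp of nat.

Definition program := seq instr.

Record config := Config { pc : nat; mem : nat -> nat }.

Definition upd (m : nat -> nat) (a v : nat) : nat -> nat :=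
  fun x => if x == a then v else m x.

Definition exec (i : instr) (c : config) : config :=
  let m := mem c in let p := pc c in
  match i with
  | IConst r k => Config p.+1 (upd m r k)
  | IAdd r a b => Config p.+1 (upd m r (m a + m b))
  | ISub r a b => Config p.+1 (upd m r (m a - m b))
  | ILoad r a => Config p.+1 (upd m r (m (m a)))
  | IStore a r => Config p.+1 (upd m (m a) (m r))
  | IJz r l => if m r == 0 then Config l m else Config p.+1 m
  | IJmp l => Config l m
  end.

(* one step; None when halted (pc outside the program) *)
Definition step (P : program) (c : config) : option config :=
  if onth P (pc c) is Some i then Some (exec i c) else None.

Fixpoint run (P : program) (t : nat) (c : config) : option config :=
  match step P c with
  | None => Some c
  | Some c' => if t is t'.+1 then run P t' c' else None
  end.

Definition init (w : seq nat) : config :=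
  Config 0 (fun a => if a is a'.+1 then nth 0 w a' else size w).

Definition output (c : config) : seq nat := mkseq (fun i => mem c i.+1) (mem c 0).

(* input size (values in a valid encoding are bounded by its length anyway) *)
Definition insize (w : seq nat) : nat := size w + sumn w.

Definition enc_list (s : seq nat) : seq nat := size s :: s.

Definition encode (n : nat) (T : seq nat) (S : seq (seq nat)) : seq nat :=
  n :: enc_list T ++ size S :: flatten (map enc_list S).

(* Main.v *)
Require Import Defs.
From mathcomp Require Import all_boot all_algebra zify.
Import GRing.Theory Num.Theory.

Set Implicit Arguments. Unset Strict Implicit. Unset Printing Implicit Defensive.

(** With at most one occurrence per feature the exemplars are pairwise disjoint,
    so the margin of a sub-collection is the sum over its members of
    (blue features) - (red features), and the exemplars for which this
    difference is positive form an optimal sub-collection. The RAM program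
    computes each difference by testing every feature of the groundset for
    membership in the exemplar and in the target, which takes cubic time and is
    insensitive to repetitions in the lists. It is written with straight-line
    blocks and while loops only, and verified by a weakest-precondition calculus
    that carries a bound on the number of steps. *)

Definition memory := nat -> nat.

(** * Structured programs *)

Inductive com :=
| Blk of seq instr
| Seq of com & com
| While of nat & com.

Fixpoint clen (c : com) : nat :=
  match c with
  | Blk l => size l
  | Seq c1 c2 => clen c1 + clen c2
  | While _ c => (clen c).+2
  end.

(** Jump targets are absolute, hence the load address [off]. A loop adds an exit test in front and a
    jump back at the end. *)
Fixpoint compile (off : nat) (c : com) : program :=
  match c with
  | Blk l => l
  | Seq c1 c2 => compile off c1 ++ compile (off + clen c1) c2
  | While r c => IJz r (off + (clen c).+2) :: rcons (compile off.+1 c) (IJmp off)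
  end.

Lemma size_compile c off : size (compile off c) = clen c.
Proof.
elim: c off => [l|c1 IH1 c2 IH2|r c IH] off //=; first by rewrite size_cat IH1 IH2.
by rewrite size_rcons IH.
Qed.

Definition straight (i : instr) : bool :=
  match i with IJz _ _ | IJmp _ => false | _ => true end.

Definition mexec (m : memory) (i : instr) : memory := Defs.mem (exec i (Config 0 m)).

Definition mexecs (l : seq instr) (m : memory) : memory := foldl mexec m l.

(** Exactly [t] steps, with [None] for halting too early; unlike runs with fuel, such executions
    concatenate. *)
Definition steps (P : program) (t : nat) (c : config) : option config :=
  iter t (obind (step P)) (Some c).

Arguments steps : simpl never.

Lemma stepsS P t c c' :
  step P c = Some c' -> steps P t.+1 c = steps P t c'.
Proof. by move=> h; rewrite /steps iterSr /= h. Qed.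

Lemma steps_trans P t1 t2 c1 c2 c3 :
  steps P t1 c1 = Some c2 -> steps P t2 c2 = Some c3 ->
  steps P (t1 + t2) c1 = Some c3.
Proof. by rewrite /steps addnC iterD => ->. Qed.

Lemma run_steps P t K c c' :
  steps P t c = Some c' -> step P c' = None -> t <= K -> run P K c = Some c'.
Proof.
elim: t K c => [|t IH] K c.
  by case=> -> h _; case: K => [|K] /=; rewrite h.
rewrite /steps iterSr /=; case E: (step P c) => [c1|]; last first.
  by rewrite (_ : iter _ _ None = None) //; elim: (t) => //= k ->.
case: K => // K h1 h2 h3 /=; rewrite E.
exact: IH h1 h2 h3.
Qed.

Lemma onth_mid (u v : program) i : onth (u ++ i :: v) (size u) = Some i.
Proof. by elim: u. Qed.

Lemma step_mid (u v : program) i m :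
  step (u ++ i :: v) (Config (size u) m) = Some (exec i (Config (size u) m)).
Proof. by rewrite /step /= onth_mid. Qed.

(** Total correctness within [K] steps. Quantifying over the surrounding code [u] and [v] lets a
    fragment be verified once for every position. *)
Definition wp (c : com) (K : nat) (Q : memory -> Prop) (m : memory) : Prop :=
  forall u v : program, exists t m',
    [/\ t <= K,
        steps (u ++ compile (size u) c ++ v) t (Config (size u) m)
          = Some (Config (size u + clen c) m')
      & Q m'].

Lemma wp_mono c K K' (Q Q' : memory -> Prop) m :
  wp c K Q m -> K <= K' -> (forall m', Q m' -> Q' m') -> wp c K' Q' m.
Proof.
move=> h hK hQ u v; have [t [m' [h1 h2 h3]]] := h u v.
by exists t, m'; split; [exact: leq_trans h1 hK| |exact: hQ].
Qed.

Lemma wp_blk l (Q : memory -> Prop) m :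
  all straight l -> Q (mexecs l m) -> wp (Blk l) (size l) Q m.
Proof.
move=> hl hQ u v; exists (size l), (mexecs l m); split=> // {hQ} /=.
elim: l m u hl => [|i l IH] m u /=; first by rewrite addn0.
move=> /andP[hi hl]; rewrite (stepsS _ (step_mid _ _ _ _)).
have -> : exec i (Config (size u) m) = Config (size (rcons u i)) (mexec m i).
  by rewrite size_rcons; case: i hi.
by rewrite -cat_rcons (IH _ (rcons u i) hl) size_rcons addSnnS.
Qed.

Lemma wp_seq c1 c2 K1 K2 (Q : memory -> Prop) m :
  wp c1 K1 (wp c2 K2 Q) m -> wp (Seq c1 c2) (K1 + K2) Q m.
Proof.
move=> h u v /=.
have [t1 [m1 [ht1 hs1 h2]]] := h u (compile (size u + clen c1) c2 ++ v).
have [t2 [m2 [ht2 hs2 hQ]]] := h2 (u ++ compile (size u) c1) v.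
exists (t1 + t2), m2; split=> //; first exact: leq_add.
apply: steps_trans (_ : _ = Some (Config (size u + clen c1) m1)) _.
  by rewrite -catA; exact: hs1.
by move: hs2; rewrite size_cat size_compile -!catA addnA.
Qed.

(** The loop register holds the exact number of rounds left, which gives termination and the bound
    at once: each round costs the body, a test and a jump, and the last test adds one. *)
Lemma wp_while r c K (Inv : nat -> memory -> Prop) (Q : memory -> Prop) k m :
  (forall k m, Inv k m -> m r = k) ->
  (forall k m, Inv k.+1 m -> wp c K (Inv k) m) ->
  Inv k m -> (forall m, Inv 0 m -> Q m) ->
  wp (While r c) (k * K.+2 + 1) Q m.
Proof.
move=> hr hc hk hQ u v /=.
set i0 := IJz _ _; set P := u ++ _.
have hjz m0 : step P (Config (size u) m0) =
    Some (if m0 r == 0 then Config (size u + (clen c).+2) m0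
          else Config (size u).+1 m0).
  by rewrite /P step_mid.
elim: k m hk => [|k IH] m hk.
  exists 1, m; rewrite (stepsS _ (hjz _)) (hr _ _ hk) eqxx.
  by split=> //; exact: hQ.
(* The body runs between its own exit test and jump back; [eP] identifies this context with [P]. *)
have [t1 [m1 [ht1 hs1 hk1]]] :=
  hc _ _ hk (rcons u i0) (IJmp (size u) :: v).
have [t2 [m2 [ht2 hs2 hQ2]]] := IH _ hk1.
have eP : rcons u i0 ++ compile (size (rcons u i0)) c ++ IJmp (size u) :: v = P.
  by rewrite /P cat_rcons size_rcons cat_rcons.
rewrite eP size_rcons in hs1.
exists (1 + (t1 + (1 + t2))), m2; split=> //; first by lia.
rewrite (stepsS _ (hjz _)) (hr _ _ hk) /=.
apply: steps_trans hs1 _; rewrite -hs2; apply: stepsS.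
have -> : (size u).+1 + clen c = size (rcons u i0 ++ compile (size u).+1 c).
  by rewrite size_cat size_rcons size_compile.
have -> : P = (rcons u i0 ++ compile (size u).+1 c) ++ IJmp (size u) :: v.
  by rewrite -eP size_rcons -!catA.
by rewrite step_mid.
Qed.

Lemma wp_run c K Q w :
  wp c K Q (Defs.mem (init w)) ->
  exists2 cfg, run (compile 0 c) K (init w) = Some cfg & Q (Defs.mem cfg).
Proof.
move=> /(_ [::] [::]) [t [m' [ht]]]; rewrite /= cats0 add0n => hs hQ.
exists (Config (clen c) m') => //; apply: run_steps hs _ ht.
by rewrite /step /= onth_default ?size_compile.
Qed.

(** * Symbolic evaluation of memory updates *)

Lemma upd_eq m a b v : b = a -> upd m a v b = v.
Proof. by move=> ->; rewrite /upd eqxx. Qed.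

Lemma upd_ne m a b v : b <> a -> upd m a v b = m b.
Proof. by move=> /eqP/negbTE h; rewrite /upd h. Qed.

(* A read is resolved only once both addresses are [upd]-free, so nested reads are
   simplified from the inside out. *)
Ltac mem_simp :=
  repeat match goal with
  | |- context [upd ?m ?a ?v ?b] =>
      lazymatch constr:((a, b)) with context [upd _ _ _ _] => fail | _ => idtac end;
      first [ constr_eq a b; rewrite (@upd_eq m a b v); [| reflexivity]
            | rewrite (@upd_ne m a b v); [| solve [discriminate | lia]]
            | rewrite (@upd_eq m a b v); [| solve [reflexivity | lia]] ]
  end.

Ltac block_exec := rewrite /mexecs /= /mexec /=; mem_simp.

(** * Membership counting *)

(* Cells 0 to 20 are registers. Once the input w is relocated to a base B:
   1 = the constant one, 2 = B, 3 = n, 4 = address of T,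
   5 = address of the current exemplar, 6 = exemplars left,
   7 = index of the current exemplar, 8 = end of the output (which starts at 2B),
   9 and 10 = blue and red counters, 11 = current feature. *)

Definition list_at (m : memory) (a : nat) (s : seq nat) : Prop :=
  m a = size s /\ forall i, i < size s -> m (a + i.+1) = nth 0 s i.

(* Puts in register 17 the number of occurrences of register 11 in the
   length-prefixed list at the address held in register 13. *)
Definition count_com : com :=
  Seq (Blk [:: IConst 17 0; ILoad 12 13])
      (While 12 (Blk [:: IAdd 13 13 1; ILoad 14 13;
                         ISub 15 14 11; ISub 16 11 14; IAdd 15 15 16;
                         ISub 15 1 15; IAdd 17 17 15; ISub 12 12 1])).

(** With truncated subtraction, [1 - ((a - b) + (b - a))] is the equality test. An address above 20
    keeps the list clear of the registers being overwritten. *)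
Lemma wp_count s m :
  m 1 = 1 -> 20 < m 13 -> list_at m (m 13) s ->
  wp count_com (10 * size s + 3)
     (fun m' => m' 17 = count_mem (m 11) s
                /\ forall a, a < 12 \/ 17 < a -> m' a = m a) m.
Proof.
move=> h1 h13 [hsz hs].
set K := _ + 3; have -> : K = 2 + (size s * 8.+2 + 1) by rewrite /K; lia.
apply: wp_seq; apply: wp_blk => //.
pose Inv k m' := [/\ m' 12 = k, m' 13 = m 13 + (size s - k), k <= size s,
  m' 17 = count_mem (m 11) (take (size s - k) s)
  & forall a, a < 12 \/ 17 < a -> m' a = m a].
apply: (@wp_while _ _ _ Inv).
- by move=> k m' [].
- move=> k m' [e12 e13 hk e17 hfr].
  have f1 : m' 1 = 1 by rewrite hfr; lia.
  have f11 : m' 11 = m 11 by rewrite hfr; lia.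
  have hv : m' (m' 13 + 1) = nth 0 s (size s - k.+1).
    by rewrite hfr ?e13 -?addnA ?addn1 ?hs; lia.
  apply: wp_blk => //; split; try by block_exec; lia.
  + have -> : size s - k = (size s - k.+1).+1 by lia.
    rewrite (take_nth 0); last by lia.
    block_exec; rewrite f1 hv f11 e17 -cats1 count_cat /=; case: eqP; lia.
  + by move=> a ha; block_exec; exact: hfr.
- rewrite /Inv subnn take0; split=> //; try by block_exec; lia.
  by move=> a ha; block_exec.
- move=> m' [_ _ _]; rewrite subn0 take_size => -> hfr; split=> //.
Qed.

(** * Gain of one exemplar *)

Definition blue_in (n : nat) (T E : seq nat) : nat :=
  count (fun x => (x \in E) && (x \in T)) (iota 1 n).

Definition red_in (n : nat) (T E : seq nat) : nat :=
  count (fun x => (x \in E) && (x \notin T)) (iota 1 n).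

(* With e = [x \notin E] and t = [x \notin T], the two increments are the
   truncated differences 1 - (e + t) and t - e. *)
Definition feature_com : com :=
  Seq (Blk [:: IConst 13 0; IAdd 13 13 5])
 (Seq count_com
 (Seq (Blk [:: ISub 18 1 17; IConst 13 0; IAdd 13 13 4])
 (Seq count_com
      (Blk [:: ISub 17 1 17; IAdd 12 17 18; ISub 12 1 12; IAdd 9 9 12;
               ISub 12 17 18; IAdd 10 10 12; ISub 11 11 1])))).

Lemma list_at_eq m m' a s :
  list_at m a s -> 20 < a -> (forall b, 20 < b -> m' b = m b) -> list_at m' a s.
Proof.
by move=> [h1 h2] ha h; split=> [|i hi]; rewrite h ?h1 ?h2 //; lia.
Qed.

(** Truncation turns [1 - count] into non-membership, however often a feature is repeated. Register
    18 keeps it for the exemplar while the target is scanned. *)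
Lemma wp_feature T E m :
  m 1 = 1 -> 20 < m 4 -> 20 < m 5 -> list_at m (m 4) T -> list_at m (m 5) E ->
  wp feature_com (10 * (size T + size E) + 18)
     (fun m' => [/\ m' 9 = m 9 + ((m 11 \in E) && (m 11 \in T)),
                    m' 10 = m 10 + ((m 11 \in E) && (m 11 \notin T)),
                    m' 11 = m 11 - 1
                  & forall a, a < 9 \/ 18 < a -> m' a = m a]) m.
Proof.
move=> h1 h4 h5 hT hE.
set K := _ + 18.
have -> : K = 2 + (10 * size E + 3 + (3 + (10 * size T + 3 + 7))).
  by rewrite /K; lia.
apply: wp_seq; apply: wp_blk => //; set m1 := mexecs _ _.
have fr1 a : a <> 13 -> m1 a = m a by move=> ha; rewrite /m1; block_exec.
have e13 : m1 13 = m 5 by rewrite /m1; block_exec.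
apply: wp_seq; apply: (wp_mono (K := 10 * size E + 3)) => //.
  apply: (@wp_count E); rewrite ?e13 ?fr1 //.
  by apply: list_at_eq hE _ _ => // b hb; rewrite fr1 //; lia.
move=> m2 [e17 fr2].
apply: wp_seq; apply: wp_blk => //; set m3 := mexecs _ _.
have fr3 a : a < 12 \/ 18 < a -> m3 a = m a.
  by move=> ha; rewrite /m3; block_exec; rewrite fr2 ?fr1; lia.
have e18 : m3 18 = (m 11 \notin E).
  rewrite /m3; block_exec; rewrite fr2 ?fr1 ?h1 ?e17 ?fr1 //; last by left.
  by rewrite -has_pred1 has_count; lia.
have e13' : m3 13 = m 4.
  by rewrite /m3; block_exec; rewrite fr2 ?fr1 //; left.
apply: wp_seq; apply: (wp_mono (K := 10 * size T + 3)) => //.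
  apply: (@wp_count T); rewrite ?e13' ?fr3 //; try by left.
  by apply: list_at_eq hT _ _ => // b hb; rewrite fr3 //; lia.
move=> m4 [f17 fr4].
have g17 : 1 - m4 17 = (m 11 \notin T).
  by rewrite f17 fr3 -?has_pred1 ?has_count; lia.
have g18 : m4 18 = (m 11 \notin E) by rewrite fr4 ?e18; lia.
have fr5 a : a < 12 \/ 18 < a -> m4 a = m a.
  by move=> ha; rewrite fr4 ?fr3; lia.
have g1 : m4 1 = 1 by rewrite fr5 //; left.
apply: wp_blk => //; split.
- block_exec; rewrite g1 g17 g18 fr5; last by left.
  by case: (_ \in E); case: (_ \in T).
- block_exec; rewrite g1 g17 g18 fr5; last by left.
  by case: (_ \in E); case: (_ \in T).
- by block_exec; rewrite g1 fr5 //; left.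
- by move=> a ha; block_exec; apply: fr5; lia.
Qed.

Definition gain_com : com :=
  Seq (Blk [:: IConst 9 0; IConst 10 0; IConst 11 0; IAdd 11 11 3])
      (While 11 feature_com).

Lemma wp_gain n T E m :
  m 1 = 1 -> m 3 = n -> 20 < m 4 -> 20 < m 5 ->
  list_at m (m 4) T -> list_at m (m 5) E ->
  wp gain_com (n * (10 * (size T + size E) + 20) + 5)
     (fun m' => [/\ m' 9 = blue_in n T E, m' 10 = red_in n T E
                  & forall a, a < 9 \/ 18 < a -> m' a = m a]) m.
Proof.
move=> h1 h3 h4 h5 hT hE.
set K := _ + 5.
have -> : K = 4 + (n * (10 * (size T + size E) + 18).+2 + 1) by rewrite /K; lia.
apply: wp_seq; apply: wp_blk => //.
(* Features are visited from [n] downwards, so those above [k] have been treated. *)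
pose Inv k m' := [/\ m' 11 = k, k <= n,
  m' 9 = count (fun x => (x \in E) && (x \in T)) (iota k.+1 (n - k)),
  m' 10 = count (fun x => (x \in E) && (x \notin T)) (iota k.+1 (n - k))
  & forall a, a < 9 \/ 18 < a -> m' a = m a].
apply: (@wp_while _ _ _ Inv).
- by move=> k m' [].
- move=> k m' [e11 hk e9 e10 hfr].
  have f4 : m' 4 = m 4 by apply: hfr; left.
  have f5 : m' 5 = m 5 by apply: hfr; left.
  have hfr' b : 20 < b -> m' b = m b by move=> hb; apply: hfr; lia.
  apply: (wp_mono (K := 10 * (size T + size E) + 18)) => //.
  + apply: (@wp_feature T E); rewrite ?f4 ?f5 ?hfr //; try by left.
    * exact: list_at_eq hT _ hfr'.
    * exact: list_at_eq hE _ hfr'.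
  + move=> m2 [g9 g10 g11 gfr]; split; first by rewrite g11 e11; lia.
    * by lia.
    * have -> : n - k = (n - k.+1).+1 by lia.
      by rewrite g9 e9 e11 /= addnC.
    * have -> : n - k = (n - k.+1).+1 by lia.
      by rewrite g10 e10 e11 /= addnC.
    * by move=> a ha; rewrite gfr ?hfr.
- rewrite /Inv subnn; split=> //.
  by move=> a ha; block_exec.
- by move=> m' [_ _ e9 e10 hfr]; split=> //; rewrite ?e9 ?e10 subn0.
Qed.

(** * Selection of the exemplars of positive gain *)

Definition positive_gain n T (S : seq (seq nat)) (j : nat) : bool :=
  red_in n T (nth [::] S j) < blue_in n T (nth [::] S j).

Definition selected n T S (j : nat) : seq nat :=
  [seq i <- iota 0 j | positive_gain n T S i].

Lemma selectedS n T S j :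
  selected n T S j.+1
  = selected n T S j ++ (if positive_gain n T S j then [:: j] else [::]).
Proof. by rewrite /selected -addn1 iotaD filter_cat /= add0n. Qed.

Lemma size_selected n T S j : size (selected n T S j) <= j.
Proof. by rewrite size_filter (leq_trans (count_size _ _)) ?size_iota. Qed.

Definition holds (m : memory) (B : nat) (w : seq nat) : Prop :=
  forall i, i < size w -> m (B + i) = nth 0 w i.

Lemma holds_list_at m B u s v :
  holds m B (u ++ enc_list s ++ v) -> list_at m (B + size u) s.
Proof.
move=> h; split=> [|i hi].
  by rewrite h ?nth_cat ?ltnn ?subnn // !size_cat /=; lia.
rewrite -addnA h ?size_cat /=; last by lia.
have -> := nth_cat 0 u; have -> : (size u + i.+1 < size u) = false by lia.
by rewrite addKn /= nth_cat hi.
Qed.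

(** Position in the encoding of the length cell of exemplar [j]; the 3 counts the cells of [n],
    [size T] and [size S]. *)
Definition exemplar_offset (T : seq nat) (S : seq (seq nat)) (j : nat) : nat :=
  3 + size T + size (flatten (map enc_list (take j S))).

Lemma exemplar_offsetS T S j :
  j < size S ->
  exemplar_offset T S j.+1
  = exemplar_offset T S j + size (nth [::] S j) + 1.
Proof.
move=> hj; rewrite /exemplar_offset (take_nth [::]) // map_rcons -cats1.
by rewrite flatten_cat size_cat /= cats0; lia.
Qed.

Lemma encode_exemplar n T S j :
  j < size S ->
  exists u v, encode n T S = u ++ enc_list (nth [::] S j) ++ v
              /\ size u = exemplar_offset T S j.
Proof.
move=> hj.
exists (n :: enc_list T ++ size S :: flatten (map enc_list (take j S))).
exists (flatten (map enc_list (drop j.+1 S))); split.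
  rewrite /encode -{2}(cat_take_drop j S) (drop_nth [::] hj) map_cat flatten_cat.
  by rewrite /= -!catA.
by rewrite /exemplar_offset /= size_cat /=; lia.
Qed.

Lemma leq_size_encode n T S : size S <= size (encode n T S).
Proof.
rewrite /encode /= size_cat /=.
suff : size S <= size (flatten (map enc_list S)) by lia.
by elim: S => //= E S IH; rewrite size_cat; lia.
Qed.

Definition select_init : com :=
  Blk [:: ILoad 3 2; IAdd 4 2 1; ILoad 5 4; IAdd 5 5 4; IAdd 5 5 1;
          ILoad 6 5; IAdd 5 5 1; IConst 7 0; IAdd 8 2 2].

(** Branch-free selection: the index is always written at the end of the output, and this end
    advances by [1 - (1 - (blue - red))], which is 1 exactly when the gain is positive. *)
Definition select_step : com :=
  Seq gain_com
      (Seq (Blk [:: ISub 9 9 10; ISub 9 1 9; ISub 9 1 9; IStore 8 7])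
           (Blk [:: IAdd 8 8 9; ILoad 12 5; IAdd 5 5 12; IAdd 5 5 1; IAdd 7 7 1; ISub 6 6 1])).

Definition select_com : com := Seq select_init (While 6 select_step).

Section Select.

Variables (n B : nat) (T : seq nat) (S : seq (seq nat)).
Let w := encode n T S.
Hypothesis B_gt : 20 < B.
Hypothesis size_w : size w < B.

(** The input lies between [B] and [2 * B] and the output grows from [2 * B], so writing the output
    never damages the input. *)
Record select_inv (k : nat) (m : memory) : Prop := SelectInv {
  sel_r1 : m 1 = 1;
  sel_r2 : m 2 = B;
  sel_r3 : m 3 = n;
  sel_r4 : m 4 = B + 1;
  sel_r5 : m 5 = B + exemplar_offset T S (size S - k);
  sel_r6 : m 6 = k;
  sel_r7 : m 7 = size S - k;
  sel_r8 : m 8 = 2 * B + size (selected n T S (size S - k));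
  sel_le : k <= size S;
  sel_in : holds m B w;
  sel_out : holds m (2 * B) (selected n T S (size S - k)) }.

Lemma wp_select_step k m :
  select_inv k.+1 m ->
  wp select_step (n * (20 * size w + 20) + 15) (select_inv k) m.
Proof.
case=> r1 r2 r3 r4 r5 r6 r7 r8 hk hin hout.
set j := size S - k.+1 in r5 r7 r8 hout.
have hj : j < size S by rewrite /j; lia.
have [u [v [ew su]]] := encode_exemplar n T hj.
set E := nth [::] S j in ew.
have hE : list_at m (m 5) E.
  by rewrite r5 -su; apply: (holds_list_at (v := v)); rewrite -ew.
have hT : list_at m (m 4) T by rewrite r4; exact: (@holds_list_at _ _ [:: n] _ _ hin).
have sT : size T <= size w by rewrite /w /encode /= size_cat; lia.
have sE : size E <= size w by rewrite /w ew !size_cat /=; lia.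
have hK : n * (10 * (size T + size E) + 20) <= n * (20 * size w + 20).
  by rewrite leq_mul2l; lia.
apply: (wp_mono (K := n * (10 * (size T + size E) + 20) + 5 + (4 + 6))
                (Q := select_inv k)) => //; last by lia.
apply: wp_seq; apply: (wp_mono (K := n * (10 * (size T + size E) + 20) + 5)) => //.
  by apply: wp_gain => //; rewrite ?r4 ?r5; lia.
move=> m2 [e9 e10 fr].
have f1 : m2 1 = 1 by rewrite fr //; left.
have b8 : 2 * B <= m 8 by rewrite r8; lia.
have f8 : m2 8 = m 8 by rewrite fr //; left.
apply: wp_seq; apply: wp_blk => //; set m3 := mexecs _ _.
have g9 : m3 9 = positive_gain n T S j.
  rewrite /m3; block_exec; rewrite f1 e9 e10 /positive_gain -/E; lia.
have gj : m3 (m 8) = j.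
  by rewrite /m3; block_exec; rewrite fr ?r7 //; left.
have gfr a : a < 9 \/ 18 < a -> a <> m 8 -> m3 a = m a.
  by move=> ha na; rewrite /m3; block_exec; exact: fr.
have glow a : a < 9 -> m3 a = m a by move=> ha; apply: gfr; lia.
have b5 : B <= m 5 < 2 * B.
  by rewrite r5 -su; move: size_w; rewrite /w ew !size_cat /=; lia.
have g5 : m3 (m3 5) = size E.
  by rewrite (glow 5) // gfr ?(proj1 hE) //; lia.
have g1 : m3 1 = 1 by rewrite glow.
have g58 : m3 5 <> 8 by rewrite glow //; lia.
have ej : size S - k = j.+1 by rewrite /j; lia.
clearbody m3; clear hE hT sT sE hK e9 e10 fr f1 f8 m2 ew su.
apply: wp_blk => //; split; rewrite ?ej.
- by block_exec.
- by block_exec; rewrite glow.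
- by block_exec; rewrite glow.
- by block_exec; rewrite glow.
- by rewrite exemplar_offsetS // -/E; block_exec; rewrite g1 g5 glow // r5; lia.
- by block_exec; rewrite g1 glow // r6; lia.
- by block_exec; rewrite g1 glow // r7; lia.
- rewrite selectedS size_cat; block_exec; rewrite g9 glow // r8.
  by case: positive_gain => /=; lia.
- by lia.
- move=> i hi; have hi' := ltn_trans hi size_w.
  by block_exec; rewrite gfr ?hin //; lia.
- move=> i; rewrite selectedS size_cat nth_cat => hi; block_exec.
  have [lt|ge] := ltnP i (size (selected n T S j)).
    by rewrite gfr ?hout //; lia.
  (* An unselected index has been written too, but just past the end of the list. *)
  case: positive_gain hi => /=; rewrite ?addn0 ?addn1 => hi; last by lia.
  have -> : i = size (selected n T S j) by lia.
  by rewrite subnn -r8 gj.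
Qed.

Lemma wp_select m :
  m 1 = 1 -> m 2 = B -> holds m B w ->
  wp select_com (size w * (n * (20 * size w + 20) + 17) + 10)
     (fun m' => [/\ m' 1 = 1, m' 2 = B,
                    m' 8 = 2 * B + size (selected n T S (size S))
                  & holds m' (2 * B) (selected n T S (size S))]) m.
Proof.
move=> r1 r2 hin.
have sS : size S <= size w := leq_size_encode n T S.
apply: (wp_mono (K := 9 + (size S * (n * (20 * size w + 20) + 15).+2 + 1)) (Q := select_inv 0)).
- apply: wp_seq; apply: wp_blk => //.
  apply: (@wp_while _ _ _ select_inv) => //; first by move=> k m' [].
    exact: wp_select_step.
  have sT : 3 + size T <= size w by rewrite /w /encode /= size_cat /=; lia.
  have e0 : m B = n by have := hin 0 _; rewrite addn0 => ->.
  have eT : m (B + 1) = size T by have := hin 1 _; rewrite /w /= => -> //; lia.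
  have eS : m (size T + (B + 1) + 1) = size S.
    have -> : size T + (B + 1) + 1 = B + (size T).+2 by lia.
    by rewrite hin /w /= ?nth_cat ?ltnn ?subnn //; lia.
  split; rewrite ?subnn //.
  + by block_exec; rewrite r2.
  + by block_exec; rewrite r1 r2.
  + block_exec; rewrite r1 r2; mem_simp; rewrite eT /exemplar_offset take0 /=; lia.
  + by block_exec; rewrite r1 r2; mem_simp; rewrite eT; mem_simp.
  + by block_exec; rewrite r2 /=; lia.
  + by move=> i hi; block_exec; exact: hin.
- suff : size S * (n * (20 * size w + 20) + 15).+2
         <= size w * (n * (20 * size w + 20) + 17) by lia.
  by rewrite leq_mul //; lia.
- by move=> m' []; rewrite subn0 => ? ? _ _ _ _ _ ? _ _ ?; split.
Qed.

End Select.

(** * Relocation of the input and of the output *)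

(** Unrolled, since the registers of a loop would still hold input: only cell 0, the write pointer,
    and cell 1, the constant one, are at work. *)
Fixpoint saves (k i : nat) : seq instr :=
  if k is k'.+1 then [:: IAdd 0 0 1, IStore 0 i & saves k' i.+1] else [::].

Lemma savesP k i m :
  m 1 = 1 -> 1 < i -> i + k <= m 0 ->
  let m' := mexecs (saves k i) m in
  [/\ m' 0 = m 0 + k, forall a, 0 < a -> a <= m 0 -> m' a = m a
    & forall j, j < k -> m' (m 0 + 1 + j) = m (i + j)].
Proof.
elim: k i m => [|k IH] i m h1 hi hk /=; first by rewrite addn0.
set m1 := mexec (mexec m _) _.
have e0 : m1 0 = m 0 + 1 by rewrite /m1; block_exec; rewrite h1.
have fr a : 0 < a -> a <= m 0 -> m1 a = m a.
  by move=> ha ha'; rewrite /m1 /mexec /=; mem_simp.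
have es : m1 (m 0 + 1) = m i.
  by rewrite /m1 /mexec /=; mem_simp.
have [||| g0 gfr gs] := IH i.+1 m1; rewrite ?e0 ?fr //; try lia.
split.
- by rewrite -/(mexecs _ m1) g0 e0; lia.
- by move=> a ha ha'; rewrite -/(mexecs _ m1) gfr ?e0; [exact: fr|..]; lia.
- case=> [|j] hj; rewrite -/(mexecs _ m1).
    by rewrite addn0 gfr ?es ?addn0 //; lia.
  have -> : m 0 + 1 + j.+1 = m1 0 + 1 + j by lia.
  by rewrite gs // fr ?addSnnS //; lia.
Qed.

(** The pointer descends so as to end on the first output value, whose doubled address is that of
    the length. *)
Fixpoint restores (k : nat) : seq instr :=
  if k is k'.+1 then [:: ILoad k.+1 0, ISub 0 0 1 & restores k'] else [::].

Lemma restoresP k m :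
  m 1 = 1 -> 2 * k.+2 <= m 0 ->
  let m' := mexecs (restores k) m in
  [/\ m' 0 = m 0 - k, m' 1 = 1, forall a, k.+1 < a -> m' a = m a
    & forall j, j < k -> m' j.+2 = m (m 0 - k + 1 + j)].
Proof.
elim: k m => [|k IH] m h1 hk /=; first by rewrite subn0.
set m1 := mexec (mexec m _) _.
have e0 : m1 0 = m 0 - 1 by rewrite /m1; block_exec; rewrite h1.
have e1 : m1 1 = 1 by rewrite /m1 /mexec /=; mem_simp.
have ek : m1 k.+2 = m (m 0) by rewrite /m1 /mexec /=; mem_simp.
have fr a : k.+2 < a -> m1 a = m a.
  by move=> ha; rewrite /m1 /mexec /=; mem_simp.
have [|| g0 g1 gfr gs] := IH m1; rewrite ?e0 //; try lia.
rewrite -/(mexecs _ m1); split=> //.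
- by rewrite g0 e0; lia.
- by move=> a ha; rewrite gfr ?fr //; lia.
- move=> j; rewrite ltnS leq_eqVlt => /orP[/eqP ->|hj].
    by rewrite gfr // ek; congr m; lia.
  by rewrite gs // e0 fr; [congr m|]; lia.
Qed.

(* Every address is in use initially, so the size in cell 0 is first doubled
   three times and serves as a pointer to free memory. *)
Definition load_com : com :=
  Seq (Blk [:: IAdd 0 0 0; IAdd 0 0 0; IAdd 0 0 0])
 (Seq (Blk ([:: IStore 0 1; IConst 1 1] ++ saves 19 2))
 (Seq (Blk [:: IConst 2 19; ISub 2 0 2; IConst 4 21; ISub 3 2 4; IAdd 0 0 1])
      (While 3 (Blk [:: ILoad 5 4; IStore 0 5; IAdd 4 4 1; IAdd 0 0 1;
                        ISub 3 3 1])))).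

(** Cells past the input read 0, so all cells from 1 to [B - 1] can be copied. More than five
    entries put [B] above 47, clear of the registers. *)
Lemma wp_load w (B := 8 * size w) :
  5 < size w ->
  wp load_com (56 * size w + 60)
     (fun m => [/\ m 1 = 1, m 2 = B & holds m B w]) (Defs.mem (init w)).
Proof.
move=> hw; set m := Defs.mem _.
have hm a : 0 < a -> m a = nth 0 w a.-1 by case: a.
have hm0 : m 0 = size w by [].
have hB : 47 < B by rewrite /B; lia.
clearbody m.
(* Of the 40 steps, two save cell 1 and set the constant, and two go to each of the 19 cells saved
   next. *)
apply: (wp_mono (K := 3 + (40 + (5 + ((B - 21) * 5.+2 + 1))))
  (Q := fun m => [/\ m 1 = 1, m 2 = B & holds m B w])) => //; last by lia.
apply: wp_seq; apply: wp_blk => //; set m0 := mexecs _ _.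
have d0 : m0 0 = B by rewrite /m0; block_exec; rewrite hm0 /B; lia.
have dm a : 0 < a -> m0 a = nth 0 w a.-1.
  by move=> ha; rewrite -hm // /m0; block_exec.
clearbody m0; clear m hm hm0.
apply: wp_seq; apply: wp_blk => //.
rewrite /mexecs foldl_cat; set m1 := foldl _ _ [:: _; _].
have e0 : m1 0 = B by rewrite /m1 /= /mexec /=; mem_simp.
have e1 : m1 1 = 1 by rewrite /m1 /= /mexec /=; mem_simp.
have eB : m1 B = nth 0 w 0.
  by rewrite /m1 /= /mexec /=; mem_simp; rewrite dm.
have fr1 a : 1 < a < B -> m1 a = nth 0 w a.-1.
  by move=> ha; rewrite /m1 /= /mexec /=; mem_simp; apply: dm; lia.
clearbody m1.
have [||| f0 ffr fs] := @savesP 19 2 m1; rewrite ?e0 //; first by lia.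
rewrite -/(mexecs _ m1); set m2 := mexecs _ _ in f0 ffr fs *; clearbody m2.
rewrite e0 in f0 ffr fs.
have f1 : m2 1 = 1 by rewrite ffr //; lia.
have fw i : i < 20 -> m2 (B + i) = nth 0 w i.
  case: i => [|i] hi; first by rewrite addn0 ffr //; lia.
  by have := fs i hi; rewrite addn1 addSnnS => ->; rewrite fr1 //; lia.
have ffr2 a : 1 < a < B -> m2 a = nth 0 w a.-1.
  by move=> ha; rewrite ffr ?fr1; lia.
clear fs ffr eB.
apply: wp_seq; apply: wp_blk => //.
pose Inv k m' := [/\ [/\ m' 3 = k, k <= B - 21, m' 1 = 1 & m' 2 = B],
  m' 4 = B - k, m' 0 = 2 * B - 1 - k,
  forall a, 20 < a < B -> m' a = nth 0 w a.-1
  & forall i, i < B - 1 - k -> m' (B + i) = nth 0 w i].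
apply: (@wp_while _ _ _ Inv).
- by move=> k m' [[]].
- move=> k m' [[e3 hk g1 g2] g4 g0 gin gout].
  apply: wp_blk => //; split; [split| | | |].
  + by block_exec; lia.
  + by lia.
  + by block_exec.
  + by block_exec.
  + by block_exec; lia.
  + by block_exec; lia.
  + by move=> a ha; block_exec; apply: gin.
  + move=> i hi; have [lt|ge] := ltnP i (B - 1 - k.+1).
      by block_exec; exact: gout.
    have ei : i = B - 1 - k.+1 by lia.
    block_exec; rewrite g4 gin; last by lia.
    by congr nth; lia.
- rewrite /Inv; split; [split| | | |].
  + by block_exec; rewrite f0; lia.
  + by [].
  + by block_exec.
  + by block_exec; rewrite f0; lia.
  + by block_exec; lia.
  + by block_exec; rewrite f0 f1; lia.
  + by move=> a ha; block_exec; apply: ffr2; lia.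
  + by move=> i hi; block_exec; apply: fw; lia.
- move=> m' [[_ _ g1 g2] _ _ _ gout]; split=> // i hi; apply: gout.
  by rewrite /B; lia.
Qed.

(* The length is stored at twice the address of the first output value, so that
   the final doubling of cell 0 finds it when no other cell is free. *)
Definition unload_com : com :=
  Seq (Blk [:: IAdd 0 2 2; ISub 3 8 0; IAdd 4 0 0; IStore 4 3])
 (Seq (Blk [:: IConst 5 20; IAdd 6 0 5; IConst 4 21; IConst 3 0; IAdd 3 3 2])
 (Seq (While 3 (Blk [:: ILoad 7 6; IStore 4 7; IAdd 4 4 1; IAdd 6 6 1;
                        ISub 3 3 1]))
      (Blk ([:: IConst 2 19; IAdd 0 0 2]
            ++ restores 19 ++ [:: ILoad 1 0; IAdd 0 0 0; ILoad 0 0])))).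

Lemma wp_unload B s m :
  40 < B -> size s <= B ->
  m 1 = 1 -> m 2 = B -> m 8 = 2 * B + size s -> holds m (2 * B) s ->
  wp unload_com (7 * B + 60)
     (fun m' => mkseq (fun i => m' i.+1) (m' 0) = s) m.
Proof.
move=> hB hs h1 h2 h8 hout.
set Q := fun _ => _.
apply: (wp_mono (K := 4 + (5 + (B * 5.+2 + 1 + 43))) (Q := Q)) => //; last by lia.
apply: wp_seq; apply: wp_blk => //; set m1 := mexecs _ _.
have e0 : m1 0 = 2 * B by rewrite /m1; block_exec; lia.
have e1 : m1 1 = 1 by rewrite /m1; block_exec.
have e2 : m1 2 = B by rewrite /m1; block_exec.
have eout : holds m1 (2 * B) s.
  by move=> i hi; rewrite /m1; block_exec; exact: hout.
have elen : m1 (4 * B) = size s by rewrite /m1; block_exec; lia.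
clearbody m1.
apply: wp_seq; apply: wp_blk => //.
(* Always [B] values are moved, enough since [size s <= B]. They land in cells 21 to [B + 20], below
   the source. *)
pose Inv k m' := [/\ [/\ m' 3 = k, k <= B, m' 1 = 1 & m' 0 = 2 * B],
  m' 4 = 21 + (B - k), m' 6 = 2 * B + 20 + (B - k),
  forall a, 2 * B <= a -> m' a = m1 a
  & forall i, i < B - k -> m' (21 + i) = m1 (2 * B + 20 + i)].
apply: wp_seq; apply: (@wp_while _ _ _ Inv).
- by move=> k m' [[]].
- move=> k m' [[g3 hk g1 g0] g4 g6 gin gout].
  apply: wp_blk => //; split; [split| | | |].
  + by block_exec; lia.
  + by lia.
  + by block_exec.
  + by block_exec.
  + by block_exec; lia.
  + by block_exec; lia.
  + by move=> a ha; block_exec; apply: gin.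
  + move=> i hi; have [lt|ge] := ltnP i (B - k.+1).
      by block_exec; exact: gout.
    have ei : i = B - k.+1 by lia.
    by block_exec; rewrite g6 gin ?ei //; lia.
- rewrite /Inv subnn; split; [split| | | |] => //.
  + by block_exec; lia.
  + by move=> a ha; block_exec.
- move=> m2 [[_ _ g1 g0] _ _ gin gout].
  apply: wp_blk => //; rewrite /mexecs !foldl_cat; set m3 := foldl _ _ [:: _; _].
  have f0 : m3 0 = 2 * B + 19 by rewrite /m3 /= /mexec /=; mem_simp; lia.
  have f1 : m3 1 = 1 by rewrite /m3 /= /mexec /=; mem_simp.
  have ffr a : 2 < a -> m3 a = m2 a.
    by move=> ha; rewrite /m3 /= /mexec /=; mem_simp.
  clearbody m3.
  have [|| r0 r1 rfr rs] := @restoresP 19 m3; rewrite ?f0 //; first by lia.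
  rewrite -/(mexecs _ m3); set m4 := mexecs _ _ in r0 r1 rfr rs *; clearbody m4.
  rewrite f0 in r0 rs.
  have hi4 a : 2 * B <= a -> m4 a = m1 a.
    by move=> ha; rewrite rfr ?ffr ?gin //; lia.
  rewrite /Q; set m5 := foldl _ _ _.
  have c0 : m5 0 = size s.
    rewrite /m5; block_exec; rewrite -elen hi4 ?r0; last by lia.
    by congr m1; lia.
  (* Entry 0 is loaded into cell 1 at the end, entries 1 to 19 come from [restores], the others from
     the loop. *)
  have cs i : i < size s -> m5 i.+1 = nth 0 s i.
    move=> hi; rewrite -eout //; case: i hi => [|i] hi.
      by rewrite /m5; block_exec; rewrite hi4 ?r0; [congr m1|]; lia.
    have -> : m5 i.+2 = m4 i.+2.
      by rewrite /m5 /= /mexec /=; mem_simp.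
    have [lt|ge] := ltnP i 19.
      by rewrite rs // ffr ?gin; [congr m1|..]; lia.
    rewrite rfr ?ffr; try by lia.
    have -> : i.+2 = 21 + (i - 19) by lia.
    by rewrite gout; [congr m1|]; lia.
  rewrite c0; apply: (@eq_from_nth _ 0) => [|i]; rewrite size_mkseq // => hi.
  by rewrite nth_mkseq // cs.
Qed.

(** * Additivity of the margin *)

Lemma sum_mem_le1 S x :
  k_occurrence 1 S -> \sum_(j < size S) (x \in nth [::] S j) <= 1.
Proof.
move=> /(_ x); rewrite -sum1_count big_mkcond (big_nth [::]) big_mkord.
by apply: leq_trans; apply: leq_sum => j _; case: ifP.
Qed.

(** At most one exemplar contains [x], so the disjunction over [J] is a sum. Summing over indices of
    [S] makes repetitions in [J] harmless. *)
Lemma appears_sum S J x :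
  k_occurrence 1 S ->
  appears S J x = \sum_(j < size S | (j : nat) \in J) (x \in nth [::] S j) :> nat.
Proof.
move=> /(sum_mem_le1 x) h1.
set s := RHS.
have hs : s <= 1.
  apply: leq_trans h1; rewrite /s big_mkcond /=; apply: leq_sum => j _.
  by case: ifP.
(* Both sides are at most 1, so only positivity matters. *)
suff -> : appears S J x = (0 < s) by lia.
apply/hasP/idP => [[j jJ /andP[hj hx]]|].
  by rewrite /s (bigD1 (Ordinal hj)) //= hx.
rewrite lt0n sum_nat_eq0 => /forallPn[j].
by rewrite negb_imply eqb0 negbK => /andP[jJ hx]; exists (j : nat); rewrite ?ltn_ord.
Qed.

(** Exchange of the sums over features and over exemplars. *)
Lemma count_appears (p : pred nat) S J (s : seq nat) :
  k_occurrence 1 S ->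
  count (fun x => p x && appears S J x) s
  = \sum_(j < size S | (j : nat) \in J)
      count (fun x => (x \in nth [::] S j) && p x) s.
Proof.
move=> h1; rewrite -sum1_count big_mkcond /=.
under eq_bigr => x _.
  have -> : (if p x && appears S J x then 1 else 0) = p x * appears S J x.
    by case: (p x); case: (appears _ _ _).
  rewrite appears_sum // big_distrr /=; over.
rewrite exchange_big; apply: eq_bigr => j _ /=.
rewrite -sum1_count [RHS]big_mkcond; apply: eq_bigr => x _.
by case: (p x); case: (x \in _).
Qed.

Definition gain n T E : int := ((blue_in n T E)%:Z - (red_in n T E)%:Z)%R.

Lemma margin_sum n T S J :
  k_occurrence 1 S ->
  margin n T S J
  = (\sum_(j < size S | (j : nat) \in J) gain n T (nth [::] S j))%R.
Proof.
move=> h1; rewrite /margin /blue_count /red_count !count_appears //.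
by rewrite sumrB -!(big_morph Posz PoszD (erefl (Posz 0))).
Qed.

(** Termwise comparison: exemplar [j] contributes its gain or 0 on the left, and the larger of the
    two on the right. *)
Lemma margin_selected n T S J :
  k_occurrence 1 S ->
  (margin n T S J <= margin n T S (selected n T S (size S)))%R.
Proof.
move=> h1; rewrite !margin_sum // big_mkcond [X in (_ <= X)%R]big_mkcond /=.
apply: ler_sum => j _; rewrite mem_filter mem_iota /= add0n ltn_ord andbT.
rewrite /positive_gain /gain; case: (_ \in J); case: ltnP; lia.
Qed.

(** * Time bound *)

(** Six cells are guaranteed: [n], three lengths, a feature of the target, and a feature of some
    exemplar. *)
Lemma size_encode n T S :
  valid_instance n T S -> 5 < size (encode n T S) /\ n <= sumn (encode n T S).
Proof.
case=> hT _ hS Tn0 hE; rewrite /encode /= size_cat sumn_cat /=; split; last by lia.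
case: T Tn0 hT => // t T _ /= /andP[ht _].
have := hS t ht; case: S hE {hS} => //= E S /andP[hE _] _.
by case: E hE => //= x E _; rewrite size_cat; lia.
Qed.

(** * The complete program and its correctness *)

Definition tap_com : com := Seq load_com (Seq select_com unload_com).

Theorem theorem7 :
  exists (P : program) (c k : nat),
    forall (n : nat) (T : seq nat) (S : seq (seq nat)),
      valid_instance n T S -> k_occurrence 1 S ->
      exists cfg : config,
        run P (c * (insize (encode n T S)).+1 ^ k) (init (encode n T S)) = Some cfg
        /\ all (fun j => j < size S) (output cfg)
        /\ (forall J : seq nat,
              (margin n T S J <= margin n T S (output cfg))%R).
Proof.
(* The dominant cost [size w * n * size w] is cubic in the input size, [n] being an entry of [w];
   400 exceeds the sum of all coefficients. *)
exists (compile 0 tap_com), 400, 3 => n T S hv h1.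
have [hw hn] := size_encode hv; set w := encode n T S in hw hn *.
set B := 8 * size w.
set out := selected n T S (size S).
have hK : (56 * size w + 60) + ((size w * (n * (20 * size w + 20) + 17) + 10)
            + (7 * B + 60)) <= 400 * (insize w).+1 ^ 3.
  set N := (insize w).+1.
  have hN : size w <= N by rewrite /N /insize; lia.
  have hnN : n <= N by rewrite /N /insize; lia.
  have : size w * (n * (20 * size w + 20) + 17) <= N * (N * (20 * N + 20) + 17).
    by apply: leq_mul => //; rewrite leq_add2r leq_mul //; lia.
  by have : 0 < N by []; rewrite /B !expnS expn0; move: hN; clear; nia.
have sS : size S <= size w := leq_size_encode n T S.
have [cfg hrun hout] : exists2 cfg, run (compile 0 tap_com) (400 * (insize w).+1 ^ 3) (init w) = Some cfg
    & mkseq (fun i => Defs.mem cfg i.+1) (Defs.mem cfg 0) = out.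
  apply: (@wp_run _ _ (fun m => mkseq (fun i => m i.+1) (m 0) = out)).
  apply: wp_mono hK _; last by move=> m; exact: id.
  apply: wp_seq; apply: wp_mono (wp_load hw) (leqnn _) _ => m [r1 r2 hin].
  apply: wp_seq.
  apply: wp_mono (wp_select _ _ r1 r2 hin) (leqnn _) _; rewrite -/w; try lia.
  move=> m' [q1 q2 q8 qs]; apply: wp_unload q1 q2 q8 qs; first by lia.
  by have := size_selected n T S (size S); lia.
exists cfg; split=> //; rewrite /output hout; split.
  by apply/allP => j; rewrite mem_filter mem_iota => /andP[].
by move=> J; exact: margin_selected.
Qed.
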